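(* Let $Q^{*}$ be the multiplicative loop of a locally compact quasifield $Q$ of dimension $2$ containing a $1$-dimensional compact normal subloop. The quasifield $Q$ is the field $\mathbb C$ of complex numbers if and only if $\mathcal T$ is a normal subset in the set of all left translations of $Q^{*}$, where $$\mathcal T=\left\{\begin{pmatrix}\cos t&\sin t\\-\sin t&\cos t\end{pmatrix}\begin{pmatrix}a(1,t)&b(1,t)\\0&a^{-1}(1,t)\end{pmatrix}: t\in[0,2\pi)\right\}$$ is the set of left translations of the compact subloop.
   Context: A left quasifield $(Q,+,* )$ has $(Q,+)$ an abelian group, $Q^*=(Q\setminus\{0\},* )$ a loop with identity, and $x*(y+z)=x*y+x*z$. Its kernel is $K_r=\{k\in Q:(x+y)*k=x*k+y*k,\ (x*y)*k=x*(y*k)\ \forall x,y\}$. Here $Q$ is a locally compact connected topological quasifield of dimension $2$ over $K_r\cong\mathbb R$ (continuous addition and multiplication, $Q^*$ a topological loop). Identify $Q$ with $\mathbb R^2$ with $(1,0)^t$ as identity of $Q^*$ and $K_r=\{(x,0)^t\}$. The left translations $x\mapsto m*x$ of $Q^*$ are linear, topologically generate $\mathrm{GL}_2^+(\mathbb R)$, and are the matrices $u\begin{pmatrix}\cos t&\sin t\\-\sin t&\cos t\end{pmatrix}\begin{pmatrix}a(u,t)&b(u,t)\\0&a^{-1}(u,t)\end{pmatrix}$, $u>0$, $t\in[0,2\pi)$, with $a,b$ continuous, $a>0$, $a(1,0)=1$, $b(1,0)=0$, $a^{-1}(u,t)=1/a(u,t)$. A subloop $N$ of a loop $L$ is normal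 if $x\cdot N=N\cdot x$, $(x\cdot N)\cdot y=x\cdot(N\cdot y)$, $(N\cdot x)\cdot y=N\cdot(x\cdot y)$ for all $x,y\in L$. A subset $\mathcal T$ of the set $\Lambda$ of all left translations is a normal subset if it is invariant under conjugation by the elements of $\Lambda$. *)

(* Defs.v *)
From HB Require Import structures.
From mathcomp Require Import all_boot all_order all_algebra.
From mathcomp Require Import all_classical all_reals all_analysis.
From mathcomp Require Import complex.

Set Implicit Arguments.
Unset Strict Implicit.
Unset Printing Implicit Defensive.

Import Order.TTheory GRing.Theory Num.Theory.
Import numFieldNormedType.Exports.

Local Open Scope classical_set_scope.
Local Open Scope ring_scope.

(* A loop (D, op, e) is given by a subset D of an ambient type, stable under an
   operation op which is total on that type; its values off D are irrelevant. *)
Record is_loop (U : Type) (D : set U) (op : U -> U -> U) (e : U) : Prop := {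
  loop_unit : D e ;
  loop_closed : forall x y, D x -> D y -> D (op x y) ;
  loop_mul1x : forall x, D x -> op e x = x ;
  loop_mulx1 : forall x, D x -> op x e = x ;
  loop_ldiv : forall a b, D a -> D b -> exists! x, D x /\ op a x = b ;
  loop_rdiv : forall a b, D a -> D b -> exists! y, D y /\ op y a = b }.

(* [ld a b] is a \ b and [rd b a] is b / a. *)
Definition is_topological_loop (U : topologicalType) (D : set U)
    (op : U -> U -> U) (e : U) : Prop :=
  [/\ is_loop D op e,
      {within D `*` D, continuous (fun p : U * U => op p.1 p.2)} &
      exists ld rd : U -> U -> U,
        [/\ forall a b, D a -> D b -> D (ld a b) /\ op a (ld a b) = b,
            forall a b, D a -> D b -> D (rd b a) /\ op (rd b a) a = b,
            {within D `*` D, continuous (fun p : U * U => ld p.1 p.2)} &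
            {within D `*` D, continuous (fun p : U * U => rd p.1 p.2)}]].

Definition is_subloop (U : Type) (D N : set U) (op : U -> U -> U) (e : U) :=
  N `<=` D /\ is_loop N op e.

Definition is_normal_subloop (U : Type) (D N : set U) (op : U -> U -> U)
    (e : U) : Prop :=
  is_subloop D N op e /\
  forall x y, D x -> D y ->
    [/\ op x @` N = (op^~ x) @` N,
        (op^~ y) @` (op x @` N) = op x @` ((op^~ y) @` N) &
        (op^~ y) @` ((op^~ x) @` N) = (op^~ (op x y)) @` N].

Definition nonzero (V : zmodType) : set V := [set x | x != 0].

Definition is_left_quasifield (V : zmodType) (mul : V -> V -> V) (e : V) :=
  is_loop (@nonzero V) mul e /\
  forall x y z, mul x (y + z) = mul x y + mul x z.

Definition kernel (V : zmodType) (mul : V -> V -> V) : set V :=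
  [set k | (forall x y, mul (x + y) k = mul x k + mul y k) /\
           (forall x y, mul (mul x y) k = mul x (mul y k))].

(* Continuity of addition and opposite is part of [topologicalZmodType]. *)
Record is_lc_connected_quasifield (V : topologicalZmodType)
    (mul : V -> V -> V) (e : V) : Prop := {
  lcq_quasifield : is_left_quasifield mul e ;
  lcq_continuous : continuous (fun p : V * V => mul p.1 p.2) ;
  lcq_loop : is_topological_loop (@nonzero V) mul e ;
  lcq_locally_compact : locally_compact [set: V] ;
  lcq_connected : connected [set: V] }.

(* Lebesgue covering dimension of the subspace A is at most n: every finite
   cover of A by (traces of) open sets has an open shrinking that covers A and
   has order at most n + 1. *)
Definition covering_dim_le (U : topologicalType) (A : set U) (n : nat) : Prop :=
  forall (k : nat) (O : 'I_k -> set U),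
    (forall i, open (O i)) -> A `<=` \bigcup_i O i ->
    exists P : 'I_k -> set U,
      [/\ forall i, open (P i),
          forall i, P i `&` A `<=` O i,
          A `<=` \bigcup_i P i &
          forall x, A x -> (#|[set i : 'I_k | `[< P i x >]]%SET| <= n.+1)%N].

Definition one_dimensional (U : topologicalType) (A : set U) : Prop :=
  covering_dim_le A 1 /\ ~ covering_dim_le A 0.

Section Plane.
Variable R : realType.

Definition vec2 (x y : R) : 'cV[R]_2 :=
  \col_(i < 2) (if i == 0 then x else y).

Definition mx2 (x y z w : R) : 'M[R]_2 :=
  \matrix_(i < 2, j < 2)
    (if i == 0 then (if j == 0 then x else y) else (if j == 0 then z else w)).

(* Q = R^2 with (1,0)^t as identity, of dimension 2 over the copy
   {(x,0)^t} of R inside the kernel.  Only inclusion in the kernel is asked: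
   the kernel of the field of complex numbers is the whole field. *)
Record is_plane_quasifield (mul : 'cV[R]_2 -> 'cV[R]_2 -> 'cV[R]_2) : Prop := {
  plane_quasifield : is_lc_connected_quasifield mul (vec2 1 0) ;
  plane_kernel : forall k : R, kernel mul (vec2 k 0) ;
  plane_scale : forall (y : 'cV[R]_2) (k : R), mul y (vec2 k 0) = k *: y }.

(* The matrices of the maps x |-> m * x for m in X. *)
Definition left_translations (mul : 'cV[R]_2 -> 'cV[R]_2 -> 'cV[R]_2)
    (X : set 'cV[R]_2) : set 'M[R]_2 :=
  [set M | exists2 m, X m & forall x, mul m x = M *m x].

Definition factored_mx (a b : R -> R -> R) (u t : R) : 'M[R]_2 :=
  u *: (mx2 (cos t) (sin t) (- sin t) (cos t) *m
        mx2 (a u t) (b u t) 0 (a u t)^-1).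

Definition parameters : set (R * R) :=
  [set p | 0 < p.1 /\ 0 <= p.2 < 2 * pi].

Record parametrizes_left_translations
    (mul : 'cV[R]_2 -> 'cV[R]_2 -> 'cV[R]_2) (a b : R -> R -> R) : Prop := {
  param_a_continuous :
    {within parameters, continuous (fun p : R * R => a p.1 p.2)} ;
  param_b_continuous :
    {within parameters, continuous (fun p : R * R => b p.1 p.2)} ;
  param_a_gt0 : forall u t, parameters (u, t) -> 0 < a u t ;
  param_a10 : a 1 0 = 1 ;
  param_b10 : b 1 0 = 0 ;
  param_image : left_translations mul (@nonzero _) =
    [set factored_mx a b p.1 p.2 | p in parameters] }.

Definition calT (a b : R -> R -> R) : set 'M[R]_2 :=
  [set mx2 (cos t) (sin t) (- sin t) (cos t) *m
       mx2 (a 1 t) (b 1 t) 0 (a 1 t)^-1 | t in [set t | 0 <= t < 2 * pi]].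

Definition normal_subset (T L : set 'M[R]_2) : Prop :=
  T `<=` L /\
  forall M, L M -> [set M *m S *m invmx M | S in T] = T.

(* Isomorphism of topological quasifields onto the complex numbers; the
   regular-algebra alias ^o carries the topology of the complex modulus. *)
Definition is_complex_field
    (mul : 'cV[R]_2 -> 'cV[R]_2 -> 'cV[R]_2) : Prop :=
  exists (f : 'cV[R]_2 -> R[i]^o) (g : R[i]^o -> 'cV[R]_2),
    [/\ cancel f g /\ cancel g f,
        continuous f /\ continuous g,
        forall x y, f (x + y) = f x + f y &
        forall x y, f (mul x y) = f x * f y].

End Plane.

(* Main.v *)
Require Import Defs.
From HB Require Import structures.
From mathcomp Require Import all_boot all_order all_algebra.
From mathcomp Require Import all_classical all_reals all_analysis.
From mathcomp Require Import complex ring lra.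
Import Order.TTheory GRing.Theory Num.Theory.
Import numFieldNormedType.Exports.

(** Every left translation x |-> m * x is linear; its matrix [left_mx mul m]
    has first column m, and the factored form of the left translations makes
    its determinant u ^ 2 positive.  The set T consists of matrices S(t) of
    determinant 1, one for each direction of the first column.

    If Q is the field of complex numbers then the left translations commute
    with each other, so conjugation is trivial on T ([complex_calT_normal]).

    Conversely let T be invariant under conjugation by left translations.

    Since right divisions in the loop are unique, det (S(t) - S(t')) never
    vanishes for t < t' in [0, 2 pi[.  This triangle of parameters is convex and
    the determinant is positive at (0, pi), hence it is positive for all pairs
    t <> t' ([det_calT_mx_sub_gt0]).

    Let S in T have a real eigenvector v.  Conjugating S by the left
    translation of v gives an element of T with eigenvector (1, 0) and the same
    eigenvalue, so that this eigenvalue is 1 or -a(1, pi)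
    ([calT_eigenvalue]).  Two distinct real eigenvalues with product 1 cannot
    both be among these values, so |tr S| <= 2 ([calT_trace]).

    A purely algebraic fact: if tr(S) ^ 2 <= 4 det S then det (S M - M S) <= 0
    for every M ([det_commutator_le0]).  For a left translation M this means
    det (S - M S M^-1) <= 0; as both S and M S M^-1 are in T, the positivity
    above forces S = M S M^-1.  Thus every left translation commutes with
    every element of T ([calT_centralized]).

    The element S(pi / 2) of T is not scalar, so the left translations lie in
    the commutative algebra R[S(pi / 2)].  Its nonzero elements are exactly the
    left translations, which have positive determinant; so the characteristic
    polynomial of S(pi / 2) has no real root, and Q is a quadratic extension of
    R without zero divisors, that is C ([complex_of_centralizing]). *)

Set Implicit Arguments.
Unset Strict Implicit.
Unset Printing Implicit Defensive.

Local Open Scope classical_set_scope.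
Local Open Scope ring_scope.

(** * Matrices and vectors of size 2 *)

Lemma ord2_eq01 (i : 'I_2) : i = 0 \/ i = 1.
Proof. by case: i => [[|[|//]] lt]; [left|right]; apply/val_inj. Qed.

Lemma mx2_eta (R : realType) (M : 'M[R]_2) :
  M = mx2 (M 0 0) (M 0 1) (M 1 0) (M 1 1).
Proof.
apply/matrixP => i j; rewrite mxE.
by case: (ord2_eq01 i) => ->; case: (ord2_eq01 j) => ->.
Qed.

Lemma mulmx_mx2 (R : realType) (p q r s p' q' r' s' : R) :
  mx2 p q r s *m mx2 p' q' r' s' =
  mx2 (p * p' + q * r') (p * q' + q * s') (r * p' + s * r') (r * q' + s * s').
Proof.
apply/matrixP => i j; rewrite !mxE !big_ord_recl big_ord0 addr0 !mxE /=.
by case: (i == 0); case: (j == 0).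
Qed.

Lemma subr_mx2 (R : realType) (p q r s p' q' r' s' : R) :
  mx2 p q r s - mx2 p' q' r' s' = mx2 (p - p') (q - q') (r - r') (s - s').
Proof.
by apply/matrixP => i j; rewrite !mxE; case: (i == 0); case: (j == 0).
Qed.

Lemma det_mx2 (R : realType) (p q r s : R) :
  \det (mx2 p q r s) = p * s - q * r.
Proof.
rewrite (expand_det_row _ ord0) !big_ord_recl big_ord0 /cofactor !det_mx11.
by rewrite !mxE /= addr0 /bump /= !addn0 !expr0 expr1; ring.
Qed.

Lemma trace_mx2 (R : realType) (p q r s : R) : \tr (mx2 p q r s) = p + s.
Proof. by rewrite /mxtrace !big_ord_recl big_ord0 !mxE /= addr0. Qed.

Lemma scalar_mx2 (R : realType) (l : R) : l%:M = mx2 l 0 0 l.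
Proof.
apply/matrixP => i j; rewrite !mxE.
by case: (ord2_eq01 i) => ->; case: (ord2_eq01 j) => ->.
Qed.

Lemma vec2_eta (R : realType) (x : 'cV[R]_2) : x = vec2 (x 0 0) (x 1 0).
Proof.
by apply/matrixP => i j; rewrite mxE (ord1 j); case: (ord2_eq01 i) => ->.
Qed.

Lemma vec2_inj (R : realType) (x y x' y' : R) :
  vec2 x y = vec2 x' y' -> x = x' /\ y = y'.
Proof.
by move=> /matrixP e; split; [move: (e 0 0)|move: (e 1 0)]; rewrite !mxE.
Qed.

Lemma mulmx_vec2 (R : realType) (p q r s x y : R) :
  mx2 p q r s *m vec2 x y = vec2 (p * x + q * y) (r * x + s * y).
Proof.
apply/matrixP => i j; rewrite !mxE !big_ord_recl big_ord0 addr0 !mxE /=.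
by case: (i == 0).
Qed.

Lemma mulmx_vec_inj (R : realType) (M M' : 'M[R]_2) :
  (forall x : 'cV[R]_2, M *m x = M' *m x) -> M = M'.
Proof.
move=> e; rewrite (mx2_eta M) (mx2_eta M').
move: (e (vec2 1 0)) (e (vec2 0 1)).
rewrite {1 2}(mx2_eta M) {1 2}(mx2_eta M') !mulmx_vec2.
move=> /vec2_inj[e1 e2] /vec2_inj[e3 e4].
by congr mx2; move: e1 e2 e3 e4; rewrite !mulr0 !mulr1 !addr0 !add0r.
Qed.

Lemma scale_vec2 (R : realType) (k x y : R) :
  k *: vec2 x y = vec2 (k * x) (k * y).
Proof. by apply/matrixP => i j; rewrite !mxE; case: (i == 0). Qed.

Lemma addr_vec2 (R : realType) (x y x' y' : R) :
  vec2 x y + vec2 x' y' = vec2 (x + x') (y + y').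
Proof. by apply/matrixP => i j; rewrite !mxE; case: (i == 0). Qed.

Lemma det_opp2 (R : realType) (M : 'M[R]_2) : \det (- M) = \det M.
Proof. by rewrite -scaleN1r detZ sqrrN expr1n mul1r. Qed.

(** Modulo scalar matrices, S is a vector in the Minkowski space of traceless
    matrices with quadratic form det, and the commutator is the cross product,
    up to a scalar.  When S is timelike or lightlike, its cross product with
    any vector is never timelike. *)
Lemma det_commutator_le0 (R : realType) (S M : 'M[R]_2) :
  (\tr S) ^+ 2 <= 4 * \det S -> \det (S *m M - M *m S) <= 0.
Proof.
rewrite (mx2_eta S) (mx2_eta M).
move: (S 0 0) (S 0 1) (S 1 0) (S 1 1) (M 0 0) (M 0 1) (M 1 0) (M 1 1).
move=> p q r s m n k l; rewrite !mulmx_mx2 subr_mx2 trace_mx2 !det_mx2.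
set D := (X in X <= 0) => disc.
pose x := p - s; pose d := m - l.
have Hx : x ^+ 2 + 4 * (q * r) <= 0 by rewrite /x; lra.
have DE : D = - ((q * k - r * n) ^+ 2 + (x * n - q * d) * (r * d - x * k)).
  by rewrite /D /x /d; ring.
(* The commutator has entries C = q k - r n, A = x n - q d, B = r d - x k and -C;
   it is orthogonal to S: r A + q B + x C = 0.  Eliminating A or B and completing
   the square gives the sign of r ^ 2 D and of q ^ 2 D. *)
have rD : r ^+ 2 * D <= 0.
  have -> : r ^+ 2 * D =
      - (r * (q * k - r * n) - (x * (r * d - x * k)) / 2) ^+ 2
      + (r * d - x * k) ^+ 2 * (x ^+ 2 + 4 * (q * r)) / 4.
    by rewrite DE; field.
  have := sqr_ge0 (r * (q * k - r * n) - (x * (r * d - x * k)) / 2).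
  have := mulr_ge0_le0 (sqr_ge0 (r * d - x * k)) Hx.
  lra.
have qD : q ^+ 2 * D <= 0.
  have -> : q ^+ 2 * D =
      - (q * (q * k - r * n) - (x * (x * n - q * d)) / 2) ^+ 2
      + (x * n - q * d) ^+ 2 * (x ^+ 2 + 4 * (q * r)) / 4.
    by rewrite DE; field.
  have := sqr_ge0 (q * (q * k - r * n) - (x * (x * n - q * d)) / 2).
  have := mulr_ge0_le0 (sqr_ge0 (x * n - q * d)) Hx.
  lra.
have [r0|r0] := eqVneq r 0; last first.
  by move: rD; rewrite pmulr_rle0 // exprn_even_gt0.
have [q0|q0] := eqVneq q 0; last first.
  by move: qD; rewrite pmulr_rle0 // exprn_even_gt0.
have x0 : x = 0.
  apply/eqP; rewrite -sqrf_eq0 eq_le sqr_ge0 andbT.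
  by move: Hx; rewrite q0 mul0r mulr0 addr0.
by rewrite DE x0 q0 r0; lra.
Qed.

Lemma eigenvector_of_root (R : realType) (S : 'M[R]_2) (l : R) :
  l ^+ 2 - \tr S * l + \det S = 0 ->
  exists2 v : 'cV[R]_2, v != 0 & S *m v = l *: v.
Proof.
move=> e.
have /det0P[v v0 vS] : \det (S - l%:M)^T == 0.
  rewrite det_tr; move: e; rewrite (mx2_eta S) trace_mx2 det_mx2.
  rewrite scalar_mx2 subr_mx2 det_mx2 => e; apply/eqP.
  by rewrite -[RHS]e; ring.
exists v^T; first by rewrite -trmx0 (inj_eq trmx_inj).
apply/eqP; rewrite -subr_eq0 -mul_scalar_mx -mulmxBl.
by rewrite -[S - _]trmxK -trmx_mul vS trmx0.
Qed.

Lemma polar_inj (R : realType) (r r' t t' : R) : 0 < r -> 0 < r' ->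
  0 <= t < 2 * pi -> 0 <= t' < 2 * pi ->
  r * cos t = r' * cos t' -> r * sin t = r' * sin t' -> t = t'.
Proof.
wlog tt' : r r' t t' / t' <= t.
  move=> H r0 r'0 ht ht' c s; have [le|/ltW le] := leP t' t.
    by apply: (H r r').
  by apply/esym; apply: (H r' r).
move=> r0 r'0 /andP[_ t2] /andP[t'0 _] c s.
have cs u : cos u ^+ 2 + sin u ^+ 2 = 1 :> R by rewrite cos2Dsin2.
have rr : r = r'.
  apply/eqP; rewrite -(eqrXn2 (n := 2)) ?ltW //; apply/eqP.
  rewrite -[LHS]mulr1 -[RHS]mulr1 -{1}(cs t) -(cs t') !mulrDr -!exprMn.
  by rewrite c s.
subst r'.
have c' : cos t = cos t' by apply: (mulfI (lt0r_neq0 r0)).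
have s' : sin t = sin t' by apply: (mulfI (lt0r_neq0 r0)).
have cd : cos (t - t') = 1.
  by rewrite cosB c' s' -!expr2 cs.
have [//|ne] := eqVneq t t'; exfalso.
have d0 : 0 < (t - t') / 2 < pi.
  have : t' < t by rewrite lt_neqAle eq_sym ne.
  by move: t2 t'0 => *; apply/andP; split; lra.
have := sin_gt0_pi d0.
have : sin ((t - t') / 2) ^+ 2 = 0.
  have e : t - t' = ((t - t') / 2) *+ 2 by rewrite -mulr_natr; field.
  by move: cd; rewrite {1}e cos_mulr2n (cos2sin2 _) -mulr_natr => cd; lra.
by move=> /eqP; rewrite sqrf_eq0 => /eqP ->; rewrite ltxx.
Qed.

(** * The complex plane as a quadratic algebra *)

Lemma real_complex_continuous (R : realType) :
  continuous (fun x : R => real_complex R x : R[i]^o).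
Proof.
move=> x; apply/cvgrPdist_lt => e; rewrite ltcE /= => /andP[/eqP e0 er].
near=> y.
rewrite -raddfB normc_def /= expr0n addr0 sqrtr_sqr ltcE /= -e0 eqxx /=.
by near: y; apply: cvgr_dist_lt => //; apply: cvg_id.
Unshelve. all: by end_near.
Qed.

Lemma Re_continuous (R : realType) :
  continuous (fun z : R[i]^o => complex.Re z : R).
Proof.
move=> x.
have F : Filter (nbhs (x : R[i]^o)) by exact: nbhs_filter.
apply/(@cvgrPdist_lt _ _ _ _ F) => e e0.
have e0' : (0 : R[i]) < e%:C%C by rewrite ltcR.
have /(@cvgrPdist_lt _ _ _ _ F)/(_ _ e0') : (id : R[i]^o -> R[i]^o) @ x --> x.
  exact: cvg_id.
apply: filterS => y xy; rewrite -raddfB -ltcR.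
exact: le_lt_trans (normc_ge_Re _) xy.
Qed.

Lemma Im_continuous (R : realType) :
  continuous (fun z : R[i]^o => complex.Im z : R).
Proof.
have -> : (fun z : R[i]^o => complex.Im z : R) =
    (fun z => complex.Re (z * (- 'i%C))).
  by apply/funext => -[x y] /=; ring.
move=> z; apply: (@continuous_comp _ _ _ (fun z : R[i]^o => z * (- 'i%C))
  (fun z : R[i]^o => complex.Re z : R)); last exact: Re_continuous.
exact: mulrr_continuous.
Qed.

(** The plane with basis 1, w and multiplication w ^ 2 = 2 h w - (h ^ 2 + k ^ 2)
    is the field of complex numbers when k <> 0: w is h + i k. *)
Lemma complex_of_quadratic (R : realType)
    (mul : 'cV[R]_2 -> 'cV[R]_2 -> 'cV[R]_2) (h k : R) :
  k != 0 ->
  (forall x y x' y', mul (vec2 x y) (vec2 x' y') =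
     vec2 (x * x' - (h ^+ 2 + k ^+ 2) * (y * y'))
          (x * y' + y * x' + 2 * h * (y * y'))) ->
  is_complex_field mul.
Proof.
move=> k0 mulE.
pose f (x : 'cV[R]_2) : R[i]^o :=
  real_complex R (x 0 0) + (x 1 0)%:C%C * (Complex h k).
pose g (z : R[i]^o) : 'cV[R]_2 :=
  complex.Re z *: vec2 1 0 + complex.Im z *: vec2 (- (h / k)) k^-1.
have fE x y : f (vec2 x y) = Complex (x + y * h) (y * k).
  by rewrite /f !mxE /=; apply/eqP; rewrite eq_complex /=; apply/andP; split;
    apply/eqP; ring.
have gE x y : g (Complex x y) = vec2 (x - y * (h / k)) (y / k).
  by rewrite /g /= !scale_vec2 addr_vec2; congr vec2; ring.
have ccoord (i : 'I_2) :
    continuous (fun v : 'cV[R]_2 => real_complex R (v i 0) : R[i]^o).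
  move=> v; apply: (@continuous_comp _ _ _ (fun v : 'cV[R]_2 => v i 0)
    (fun x : R => real_complex R x : R[i]^o)).
    exact: coord_continuous.
  exact: real_complex_continuous.
exists f, g; split.
- split=> [x|[x y]].
    by rewrite (vec2_eta x) fE gE; congr vec2; field.
  by rewrite gE fE; congr Complex; field.
- split=> x.
    have c1 : {for x, continuous (fun v : 'cV[R]_2 =>
        real_complex R (v 1 0) * Complex h k : R[i]^o)}.
      apply: (@continuous_comp _ _ _
        (fun v : 'cV[R]_2 => real_complex R (v 1 0) : R[i]^o)
        (fun z : R[i]^o => z * Complex h k)); first exact: ccoord.
      exact: mulrr_continuous.
    exact: (continuousD (@ccoord 0 x) c1).
  have c0 : {for x, continuous (fun z : R[i]^o =>
      complex.Re z *: vec2 1 0 : 'cV[R]_2)}.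
    apply: (@continuous_comp R[i]^o _ _ (fun z => complex.Re z)
      (fun l : R => l *: vec2 1 0)); first exact: Re_continuous.
    exact: scalel_continuous.
  have c1 : {for x, continuous (fun z : R[i]^o =>
      complex.Im z *: vec2 (- (h / k)) k^-1 : 'cV[R]_2)}.
    apply: (@continuous_comp R[i]^o _ _ (fun z => complex.Im z)
      (fun l : R => l *: vec2 (- (h / k)) k^-1)); first exact: Im_continuous.
    exact: scalel_continuous.
  exact: (continuousD c0 c1).
- by move=> x y; rewrite (vec2_eta x) (vec2_eta y) addr_vec2 !fE;
    congr Complex; ring.
- move=> x y; rewrite (vec2_eta x) (vec2_eta y) mulE !fE.
  by congr Complex; ring.
Qed.

(** * Matrices of left translations *)

(** The matrix of the left translation by m, for all m including 0.  The first
    column is m itself because the vector (1, 0) is a right identity. *)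
Definition left_mx (R : realType) (mul : 'cV[R]_2 -> 'cV[R]_2 -> 'cV[R]_2)
    (m : 'cV[R]_2) : 'M[R]_2 :=
  mx2 (m 0 0) (mul m (vec2 0 1) 0 0) (m 1 0) (mul m (vec2 0 1) 1 0).

Lemma left_mxP (R : realType) (mul : 'cV[R]_2 -> 'cV[R]_2 -> 'cV[R]_2)
    (m x : 'cV[R]_2) :
  is_plane_quasifield mul -> mul m x = left_mx mul m *m x.
Proof.
case=> [[[_ mulD] _ _ _ _] ker scal].
have mulZ (k : R) (y : 'cV[R]_2) : mul m (k *: y) = k *: mul m y.
  by rewrite -(scal y k) -(ker k).2 scal.
have xE : x = vec2 (x 0 0) 0 + x 1 0 *: vec2 0 1.
  by rewrite {1}(vec2_eta x) scale_vec2 addr_vec2; congr vec2; ring.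
rewrite {1}xE mulD scal mulZ (vec2_eta x) mulmx_vec2.
rewrite {1}(vec2_eta m) {1}(vec2_eta (mul m (vec2 0 1))) !mxE /=.
by rewrite !scale_vec2 addr_vec2; congr vec2; ring.
Qed.

Lemma left_mx_vec10 (R : realType) (mul : 'cV[R]_2 -> 'cV[R]_2 -> 'cV[R]_2)
    (m : 'cV[R]_2) : left_mx mul m *m vec2 1 0 = m.
Proof. by rewrite mulmx_vec2 [RHS]vec2_eta; congr vec2; ring. Qed.

Lemma left_translationsE (R : realType)
    (mul : 'cV[R]_2 -> 'cV[R]_2 -> 'cV[R]_2) (X : set 'cV[R]_2) :
  is_plane_quasifield mul -> left_translations mul X = left_mx mul @` X.
Proof.
move=> hQ; apply/seteqP; split=> M.
  move=> [m Xm mM]; exists m => //.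
  by apply: mulmx_vec_inj => x; rewrite -left_mxP.
by move=> [m Xm <-]; exists m => // x; apply: left_mxP.
Qed.

(** If the left translations by m and m' agreed at v <> 0, then y * v = m * v
    would have two solutions y. *)
Lemma left_mx_sharp (R : realType) (mul : 'cV[R]_2 -> 'cV[R]_2 -> 'cV[R]_2)
    (m m' : 'cV[R]_2) :
  is_plane_quasifield mul -> m != 0 -> m' != 0 -> m != m' ->
  \det (left_mx mul m - left_mx mul m') != 0.
Proof.
move=> hQ m0 m'0; apply: contraNneq; rewrite -det_tr => /eqP/det0P[v v0 vM].
have vM' : left_mx mul m *m v^T = left_mx mul m' *m v^T.
  apply/eqP; rewrite -subr_eq0 -mulmxBl -[_ - _]trmxK -trmx_mul vM.
  by rewrite trmx0.
have nv : nonzero (v^T) by rewrite /nonzero /= -trmx0 (inj_eq trmx_inj).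
have [loopQ _] := lcq_quasifield (plane_quasifield hQ).
have nmv : nonzero (mul m v^T) by apply: (loop_closed loopQ).
have [y [_ uniq_y]] := loop_rdiv loopQ nv nmv.
rewrite -(uniq_y m) // -(uniq_y m') //; split=> //.
by rewrite !left_mxP.
Qed.

(** The loop axioms say nothing about 0 * y; its value comes from continuity of
    the multiplication along the first axis. *)
Lemma mul0_left (R : realType) (mul : 'cV[R]_2 -> 'cV[R]_2 -> 'cV[R]_2)
    (y : 'cV[R]_2) :
  is_plane_quasifield mul ->
  (forall e : R, e != 0 -> mul (vec2 e 0) y = e *: y) -> mul 0 y = 0.
Proof.
move=> hQ mule.
have cmul := lcq_continuous (plane_quasifield hQ).
have cvec : continuous (fun e : R => (e *: vec2 1 0 : 'cV[R]_2, y)).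
  move=> e; apply: (@cvg_pair _ _ _ (nbhs e)
    (nbhs (e *: vec2 1 0 : 'cV[R]_2)) (nbhs y)).
    exact: scalel_continuous.
  exact: cvg_cst.
have cl : continuous (fun e : R => mul (e *: vec2 1 0) y).
  move=> e.
  apply: (@continuous_comp _ _ _ (fun e : R => (e *: vec2 1 0 : 'cV[R]_2, y))
    (fun p => mul p.1 p.2)); [exact: cvec|exact: cmul].
have c1 : (fun e : R => mul (e *: vec2 1 0) y) x @[x --> 0^'] -->
    mul (0 *: vec2 1 0) y.
  exact: cvg_within_filter (cl 0).
have c2 : (fun e : R => e *: y) x @[x --> 0^'] --> (0 : R) *: y.
  apply: cvg_within_filter; exact: scalel_continuous.
rewrite !scale0r in c1 c2.
have := cvg_unique _ c1.
apply; first exact: norm_hausdorff.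
apply: cvg_trans c2; apply: near_eq_cvg.
near=> e.
rewrite scale_vec2 mulr1 mulr0 mule //.
by near: e; exact: nbhs_dnbhs_neq.
Unshelve. all: by end_near.
Qed.

(** * The compact family T *)

(** The element of T with parameter t; [calT a b] is its image on
    [0, 2 pi[. *)
Definition calT_mx (R : realType) (a b : R -> R -> R) (t : R) : 'M[R]_2 :=
  mx2 (cos t) (sin t) (- sin t) (cos t) *m
  mx2 (a 1 t) (b 1 t) 0 (a 1 t)^-1.

Lemma calT_mxE (R : realType) (a b : R -> R -> R) (t : R) :
  calT_mx a b t =
  mx2 (a 1 t * cos t) (b 1 t * cos t + sin t / a 1 t)
      (- (a 1 t * sin t)) (- (b 1 t * sin t) + cos t / a 1 t).
Proof. by rewrite /calT_mx mulmx_mx2; congr mx2; ring. Qed.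

Lemma parameters1 (R : realType) (t : R) :
  0 <= t < 2 * pi -> parameters ((1 : R), t).
Proof. by move=> ht; split=> //=; apply: ltr01. Qed.

Lemma det_calT_mx (R : realType) (a b : R -> R -> R)
    (mul : 'cV[R]_2 -> 'cV[R]_2 -> 'cV[R]_2) (t : R) :
  parametrizes_left_translations mul a b -> 0 <= t < 2 * pi ->
  \det (calT_mx a b t) = 1.
Proof.
move=> hab ht; rewrite /calT_mx det_mulmx !det_mx2 mulr0 subr0.
rewrite mulrN opprK -!expr2 cos2Dsin2 mul1r divff // gt_eqF //.
exact: (param_a_gt0 hab (parameters1 ht)).
Qed.

Lemma calT_mx_left (R : realType) (a b : R -> R -> R)
    (mul : 'cV[R]_2 -> 'cV[R]_2 -> 'cV[R]_2) (t : R) :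
  is_plane_quasifield mul -> parametrizes_left_translations mul a b ->
  0 <= t < 2 * pi ->
  exists2 m, m != 0 & calT_mx a b t = left_mx mul m.
Proof.
move=> hQ hab ht.
have : left_translations mul (@nonzero _) (calT_mx a b t).
  rewrite (param_image hab); exists (1, t); first exact: parameters1.
  by rewrite /factored_mx scale1r.
by rewrite left_translationsE // => -[m m0 <-]; exists m.
Qed.

Lemma det_left_mx_gt0 (R : realType) (a b : R -> R -> R)
    (mul : 'cV[R]_2 -> 'cV[R]_2 -> 'cV[R]_2) (m : 'cV[R]_2) :
  is_plane_quasifield mul -> parametrizes_left_translations mul a b ->
  m != 0 -> 0 < \det (left_mx mul m).
Proof.
move=> hQ hab m0.
have : left_translations mul (@nonzero _) (left_mx mul m).
  by rewrite left_translationsE //; exists m.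
rewrite (param_image hab) => -[[u t] put <-]; have [/= u0 ht] := put.
rewrite /factored_mx detZ det_mulmx !det_mx2 mulr0 subr0.
rewrite mulrN opprK -!expr2 cos2Dsin2 mul1r divff ?mulr1 ?exprn_gt0 //.
by rewrite gt_eqF // (param_a_gt0 hab put).
Qed.

Lemma calT_mx_vec10 (R : realType) (a b : R -> R -> R) (t : R) :
  calT_mx a b t *m vec2 1 0 = vec2 (a 1 t * cos t) (- (a 1 t * sin t)).
Proof. by rewrite calT_mxE mulmx_vec2; congr vec2; ring. Qed.

Lemma calT_mx_sharp (R : realType) (a b : R -> R -> R)
    (mul : 'cV[R]_2 -> 'cV[R]_2 -> 'cV[R]_2) (t t' : R) :
  is_plane_quasifield mul -> parametrizes_left_translations mul a b ->
  0 <= t < 2 * pi -> 0 <= t' < 2 * pi -> t != t' ->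
  \det (calT_mx a b t - calT_mx a b t') != 0.
Proof.
move=> hQ hab ht ht' tt'.
have [m m0 mE] := calT_mx_left hQ hab ht.
have [m' m'0 mE'] := calT_mx_left hQ hab ht'.
rewrite mE mE'; apply: left_mx_sharp => //.
apply: contraNneq tt' => mm'.
have := congr1 (fun M => M *m vec2 1 0)
  (etrans mE (etrans (congr1 _ mm') (esym mE'))).
rewrite !calT_mx_vec10 => /vec2_inj[c /oppr_inj s]; apply/eqP.
apply: (polar_inj _ _ ht ht' c s).
  exact: (param_a_gt0 hab (parameters1 ht)).
exact: (param_a_gt0 hab (parameters1 ht')).
Qed.

Lemma cvg_det_mx2 (R : realType) (p q r s : R -> R) (F : set_system R)
    (l1 l2 l3 l4 : R) : Filter F ->
  p @ F --> l1 -> q @ F --> l2 -> r @ F --> l3 -> s @ F --> l4 ->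
  \det (mx2 (p x) (q x) (r x) (s x)) @[x --> F] --> \det (mx2 l1 l2 l3 l4).
Proof.
move=> FF cp cq cr cs; rewrite det_mx2.
under eq_fun do rewrite det_mx2.
by apply: cvgB; apply: cvgM.
Qed.

Lemma calT_path_continuous (R : realType) (a b : R -> R -> R)
    (mul : 'cV[R]_2 -> 'cV[R]_2 -> 'cV[R]_2) (h h' : R -> R) (A : set R) :
  parametrizes_left_translations mul a b ->
  continuous h -> continuous h' ->
  (forall x, A x -> 0 <= h x < 2 * pi) ->
  (forall x, A x -> 0 <= h' x < 2 * pi) ->
  {within A, continuous
    (fun x => \det (calT_mx a b (h x) - calT_mx a b (h' x)))}.
Proof.
move=> hab ch ch' Ah Ah'.
have cvg_param (f : R -> R -> R) (g : R -> R) (x : R) :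
    {within @parameters R, continuous (fun p : R * R => f p.1 p.2)} ->
    continuous g -> (forall x, A x -> 0 <= g x < 2 * pi) -> A x ->
    f 1 (g y) @[y --> within A (nbhs x)] --> f 1 (g x).
  move=> /subspace_continuousP cf cg Ag Ax.
  have cpair : (1, g y) @[y --> within A (nbhs x)] -->
      within (@parameters R) (nbhs ((1 : R), g x)).
    have cpair : (1, g y) @[y --> x] --> nbhs ((1 : R), g x).
      by apply: (@cvg_pair _ _ _ (nbhs x) (nbhs (1 : R)) (nbhs (g x)));
        [exact: cvg_cst|exact: cg].
    move=> P /cpair nP.
    have : nbhs x [set y | parameters (1, g y) -> P (1, g y)] by exact: nP.
    apply: (@filterS _ (nbhs x)) => y /= Py Ay.
    by apply: Py; apply: parameters1; apply: Ag.
  have cf1 := cf _ (parameters1 (Ag _ Ax)).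
  exact: (@cvg_comp _ _ _ (fun y => (1, g y)) (fun p : R * R => f p.1 p.2)
    _ _ _ cpair cf1).
apply/subspace_continuousP => x Ax.
under eq_fun do rewrite !calT_mxE subr_mx2.
have [ca cb] := (param_a_continuous hab, param_b_continuous hab).
have entries (g : R -> R) : continuous g ->
    (forall x, A x -> 0 <= g x < 2 * pi) ->
    [/\ a 1 (g y) @[y --> within A (nbhs x)] --> a 1 (g x),
        b 1 (g y) @[y --> within A (nbhs x)] --> b 1 (g x),
        (a 1 (g y))^-1 @[y --> within A (nbhs x)] --> (a 1 (g x))^-1,
        cos (g y) @[y --> within A (nbhs x)] --> cos (g x) &
        sin (g y) @[y --> within A (nbhs x)] --> sin (g x)].
  move=> cg Ag; split;
    [exact: (cvg_param _ _ _ ca)|exact: (cvg_param _ _ _ cb)| | |].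
  - apply: (cvgV _ (cvg_param _ _ _ ca cg Ag Ax)).
    by rewrite gt_eqF // (param_a_gt0 hab (parameters1 (Ag _ Ax))).
  - apply: cvg_within_filter.
    exact: (continuous_comp (cg x) (@continuous_cos _ _)).
  - apply: cvg_within_filter.
    exact: (continuous_comp (cg x) (@continuous_sin _ _)).
have [a1 b1 v1 c1 s1] := entries h ch Ah.
have [a2 b2 v2 c2 s2] := entries h' ch' Ah'.
apply: cvg_det_mx2; apply: cvgB.
- exact: cvgM.
- exact: cvgM.
- by apply: cvgD; apply: cvgM.
- by apply: cvgD; apply: cvgM.
- by apply: cvgN; apply: cvgM.
- by apply: cvgN; apply: cvgM.
- by apply: cvgD; [apply: cvgN|]; apply: cvgM.
- by apply: cvgD; [apply: cvgN|]; apply: cvgM.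
Qed.

(** The determinant does not vanish on the convex set of pairs t < t', and it is
    positive at (0, pi). *)
Lemma det_calT_mx_sub_gt0 (R : realType) (a b : R -> R -> R)
    (mul : 'cV[R]_2 -> 'cV[R]_2 -> 'cV[R]_2) (t t' : R) :
  is_plane_quasifield mul -> parametrizes_left_translations mul a b ->
  0 <= t < 2 * pi -> 0 <= t' < 2 * pi -> t != t' ->
  0 < \det (calT_mx a b t - calT_mx a b t').
Proof.
move=> hQ hab.
wlog lt_tt' : t t' / t < t'.
  move=> H ht ht' ne; case: (ltgtP t t') ne => // lt _.
    by apply: H => //; rewrite lt_eqF.
  by rewrite -det_opp2 opprB; apply: H => //; rewrite lt_eqF.
move=> ht ht' ne.
have pi_gt0 := pi_gt0 R.
(* The segment from (0, pi) to (t, t'). *)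
pose h (x : R) : R := x * t; pose h' (x : R) : R := pi + x * (t' - pi).
pose D x := \det (calT_mx a b (h x) - calT_mx a b (h' x)).
have hh x : x \in `[0, 1]%R -> [/\ 0 <= h x, h x < h' x & h' x < 2 * pi].
  rewrite in_itv /= => /andP[x0 x1]; move/andP: ht => [t0 t2].
  move/andP: ht' => [t'0 t'2]; rewrite /h /h'; split; first by rewrite mulr_ge0.
    nra.
  nra.
have D0 x : x \in `[0, 1]%R -> D x != 0.
  move=> /hh[h0 hlt h2]; apply: (calT_mx_sharp hQ hab); last by rewrite lt_eqF.
    by rewrite h0 (lt_trans hlt h2).
  by rewrite (le_trans h0 (ltW hlt)) h2.
have cD : {within `[0, 1], continuous D}.
  apply: (calT_path_continuous (h := h) (h' := h') hab).
  - by move=> x; apply: cvgM; [exact: cvg_id|exact: cvg_cst].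
  - move=> x; apply: cvgD; first exact: cvg_cst.
    by apply: cvgM; [exact: cvg_id|exact: cvg_cst].
  - by move=> x /hh[h0 hlt h2]; rewrite h0 (lt_trans hlt h2).
  - by move=> x /hh[h0 hlt h2]; rewrite (le_trans h0 (ltW hlt)) h2.
have Dpos : 0 < D 0.
  rewrite /D /h /h' !mul0r addr0 !calT_mxE subr_mx2 det_mx2.
  rewrite (param_a10 hab) (param_b10 hab) cos0 sin0 cospi sinpi.
  have ap : 0 < a 1 pi.
    by apply: (param_a_gt0 hab (parameters1 _)); apply/andP; split; lra.
  have : 0 < (a 1 pi)^-1 by rewrite invr_gt0.
  rewrite !(mul0r, mulr0, mulrN1, mulr1, invr1, add0r, addr0, oppr0, subr0).
  rewrite !(opprK, mulN1r).
  by move=> vp; rewrite mulr_gt0 //; lra.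
have D1 : D 1 = \det (calT_mx a b t - calT_mx a b t').
  by rewrite /D /h /h' !mul1r subrKC.
rewrite -D1 ltNge; apply/negP => Dneg.
have [|c c01 Dc] := IVT (v := 0) (ler01 : (0 : R) <= 1) cD.
  by rewrite ge_min Dneg orbT le_max (ltW Dpos).
by have := D0 c c01; rewrite Dc eqxx.
Qed.

(** * Normality of T *)

Lemma unit_left_mx (R : realType) (a b : R -> R -> R)
    (mul : 'cV[R]_2 -> 'cV[R]_2 -> 'cV[R]_2) (m : 'cV[R]_2) :
  is_plane_quasifield mul -> parametrizes_left_translations mul a b ->
  m != 0 -> left_mx mul m \in unitmx.
Proof.
by move=> hQ hab m0; rewrite unitmxE unitfE gt_eqF // (det_left_mx_gt0 hQ hab).
Qed.

(** Conjugation by the left translation of v moves the eigenvector v to (1, 0),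
    and the elements of T with eigenvector (1, 0) have parameter 0 or pi. *)
Lemma calT_eigenvalue (R : realType) (a b : R -> R -> R)
    (mul : 'cV[R]_2 -> 'cV[R]_2 -> 'cV[R]_2)
    (S : 'M[R]_2) (l : R) (v : 'cV[R]_2) :
  is_plane_quasifield mul -> parametrizes_left_translations mul a b ->
  normal_subset (calT a b) (left_translations mul (@nonzero _)) ->
  calT a b S -> v != 0 -> S *m v = l *: v -> l = 1 \/ l = - a 1 pi.
Proof.
move=> hQ hab [_ normT] TS v0 Sv; pose M := left_mx mul v.
have uM : M \in unitmx by apply: (unit_left_mx hQ hab).
have LM : left_translations mul (@nonzero _) M.
  by rewrite left_translationsE //; exists v.
move: TS; rewrite -(normT M LM) => -[_ [t ht <-]].
rewrite -/(calT_mx a b t) => SE.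
have a0 := param_a_gt0 hab (parameters1 ht).
have : calT_mx a b t *m vec2 1 0 = l *: vec2 1 0.
  have -> : calT_mx a b t = invmx M *m S *m M.
    by rewrite -SE !mulmxA mulVmx // mul1mx mulmxKV.
  rewrite -!mulmxA left_mx_vec10 Sv -scalemxAr.
  by rewrite -{1}(left_mx_vec10 mul v) mulKmx.
rewrite calT_mx_vec10 scale_vec2 mulr1 mulr0 => /vec2_inj[c s].
have {}s : sin t = 0.
  by apply/eqP; move/eqP: s; rewrite oppr_eq0 mulf_eq0 gt_eqF.
have pi0 := pi_gt0 R.
have [t0 t2] := andP ht.
have [ltp|gtp|tp] := ltgtP t pi.
- have [/eqP t_eq0|tn0] := boolP (t == 0).
    by left; rewrite -c t_eq0 cos0 mulr1 (param_a10 hab).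
  have : 0 < sin t by apply: sin_gt0_pi; rewrite lt_neqAle eq_sym tn0 t0.
  by rewrite s ltxx.
- have : 0 < sin (t - pi) by apply: sin_gt0_pi; apply/andP; split; lra.
  by rewrite sinB sinpi mulr0 s mul0r subr0 ltxx.
- by right; rewrite -c tp cospi mulrN1.
Qed.

Lemma calT_trace (R : realType) (a b : R -> R -> R)
    (mul : 'cV[R]_2 -> 'cV[R]_2 -> 'cV[R]_2) (S : 'M[R]_2) :
  is_plane_quasifield mul -> parametrizes_left_translations mul a b ->
  normal_subset (calT a b) (left_translations mul (@nonzero _)) ->
  calT a b S -> (\tr S) ^+ 2 <= 4.
Proof.
move=> hQ hab normT TS; rewrite leNgt; apply/negP => tr4.
have detS : \det S = 1.
  by case: TS => t ht <-; rewrite -/(calT_mx a b t) (det_calT_mx hab).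
have disc0 : 0 < \tr S ^+ 2 - 4 by lra.
(* The eigenvalues (tr S + d) / 2 and (tr S - d) / 2 are distinct and have
   product 1. *)
pose d := Num.sqrt (\tr S ^+ 2 - 4).
have d0 : 0 < d by rewrite sqrtr_gt0.
have dd : d ^+ 2 = \tr S ^+ 2 - 4 by rewrite sqr_sqrtr // ltW.
have ap : 0 < a 1 pi.
  have := pi_gt0 R => pi0.
  by apply: (param_a_gt0 hab (parameters1 _)); apply/andP; split; lra.
have ev l : l ^+ 2 - \tr S * l + 1 = 0 -> l = 1 \/ l = - a 1 pi.
  rewrite -{1}detS => /eigenvector_of_root[v v0 Sv].
  exact: (calT_eigenvalue hQ hab normT TS v0 Sv).
have [|e1|e1] := ev ((\tr S + d) / 2).
- by rewrite -[RHS](mulr0 (1 / 4)) -(subrr (d ^+ 2)) {2}dd; field.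
- have [|e2|e2] := ev ((\tr S - d) / 2); last 2 first.
  + by lra.
  + by nra.
  by rewrite -[RHS](mulr0 (1 / 4)) -(subrr (d ^+ 2)) {2}dd; field.
- have [|e2|e2] := ev ((\tr S - d) / 2); last 2 first.
  + by nra.
  + by lra.
  by rewrite -[RHS](mulr0 (1 / 4)) -(subrr (d ^+ 2)) {2}dd; field.
Qed.

Lemma calT_centralized (R : realType) (a b : R -> R -> R)
    (mul : 'cV[R]_2 -> 'cV[R]_2 -> 'cV[R]_2) (S : 'M[R]_2) :
  is_plane_quasifield mul -> parametrizes_left_translations mul a b ->
  normal_subset (calT a b) (left_translations mul (@nonzero _)) ->
  calT a b S ->
  forall m, m != 0 -> S *m left_mx mul m = left_mx mul m *m S.
Proof.
move=> hQ hab normT TS m m0; set M := left_mx mul m.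
have M0 : 0 < \det M by apply: (det_left_mx_gt0 hQ hab).
have uM : M \in unitmx by apply: (unit_left_mx hQ hab).
have LM : left_translations mul (@nonzero _) M.
  by rewrite left_translationsE //; exists m.
have TS' : calT a b (M *m S *m invmx M).
  by rewrite -(normT.2 M LM); exists S.
have [t ht tS] := TS; have [t' ht' tS'] := TS'.
rewrite -/(calT_mx a b t) in tS; rewrite -/(calT_mx a b t') in tS'.
have [tt'|tt'] := eqVneq t t'.
  have SE : S = M *m S *m invmx M by rewrite -tS' -tt' tS.
  by rewrite {1}SE mulmxKV.
have := det_calT_mx_sub_gt0 hQ hab ht ht' tt'; rewrite tS tS' => pos.
have : \det (S *m M - M *m S) <= 0.
  apply: det_commutator_le0.
  have -> : \det S = 1 by rewrite -tS (det_calT_mx hab).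
  by rewrite mulr1; apply: (calT_trace hQ hab normT TS).
have -> : S *m M - M *m S = (S - M *m S *m invmx M) *m M.
  by rewrite mulmxBl mulmxKV.
by rewrite det_mulmx leNgt mulr_gt0.
Qed.

(** The matrices commuting with a non-scalar matrix S form the plane spanned by
    the identity and S, and such a matrix is determined by its first
    column. *)
Lemma complex_of_centralizing (R : realType) (a b : R -> R -> R)
    (mul : 'cV[R]_2 -> 'cV[R]_2 -> 'cV[R]_2) (p q r s : R) :
  is_plane_quasifield mul -> parametrizes_left_translations mul a b ->
  r != 0 ->
  (forall m, m != 0 ->
    mx2 p q r s *m left_mx mul m = left_mx mul m *m mx2 p q r s) ->
  is_complex_field mul.
Proof.
move=> hQ hab r0 comm.
have left_mxE x y : vec2 x y != 0 ->
    left_mx mul (vec2 x y) = mx2 x (y * q / r) y (x + y * (s - p) / r).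
  move=> /comm; rewrite /left_mx !mulmx_mx2 !mxE /=.
  set z := mul _ _ 0 0; set w := mul _ _ 1 0.
  move=> /matrixP e; move: (e 0 0) (e 1 0); rewrite !mxE /= => e1 e2.
  congr mx2.
    by apply: (mulIf r0); rewrite divfK //; lra.
  by apply: (mulIf r0); rewrite mulrDl divfK //; lra.
have disc : (s - p) ^+ 2 + 4 * (q * r) < 0.
  rewrite ltNge; apply/negP => disc0.
  pose d := Num.sqrt ((s - p) ^+ 2 + 4 * (q * r)).
  have dd : d ^+ 2 = (s - p) ^+ 2 + 4 * (q * r) by rewrite sqr_sqrtr.
  (* A real eigenvalue would make the left translation by (x, r) singular. *)
  pose x := (d - (s - p)) / 2.
  have v0 : vec2 x r != 0.
    apply: contra r0 => /eqP/matrixP/(_ 1 0); rewrite !mxE /= => ->.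
    exact: eqxx.
  have := det_left_mx_gt0 hQ hab v0; rewrite left_mxE // det_mx2.
  suff -> : x * (x + r * (s - p) / r) - r * q / r * r = 0 by rewrite ltxx.
  transitivity ((d ^+ 2 - (s - p) ^+ 2 - 4 * (q * r)) / 4).
    by rewrite /x; field.
  by rewrite dd; field.
pose h := (s - p) / (2 * r).
pose k := Num.sqrt (- ((s - p) ^+ 2 + 4 * (q * r))) / (2 * r).
have r20 : 2 * r != 0 by rewrite mulf_neq0.
have k0 : k != 0.
  by rewrite mulf_neq0 ?invr_eq0 // gt_eqF // sqrtr_gt0 oppr_gt0.
have kk : h ^+ 2 + k ^+ 2 = - (q / r).
  rewrite /k /h !expr_div_n sqr_sqrtr; last by rewrite oppr_ge0 ltW.
  by field.
apply: (complex_of_quadratic (h := h) k0) => x y x' y'; rewrite kk.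
have mul0 z : mul 0 z = 0.
  apply: (mul0_left hQ) => e e0.
  have v0 : vec2 e 0 != 0.
    by apply: contra e0 => /eqP/matrixP/(_ 0 0); rewrite !mxE /= => ->.
  rewrite left_mxP // left_mxE // (vec2_eta z) mulmx_vec2 scale_vec2.
  by congr vec2; field.
have [xy0|xy0] := eqVneq (vec2 x y) 0.
  rewrite xy0 mul0; move/matrixP: xy0 => xy0.
  move: (xy0 0 0) (xy0 1 0); rewrite !mxE /= => -> ->.
  by apply/matrixP => i j; rewrite !mxE; case: (i == 0); ring.
rewrite left_mxP // left_mxE // mulmx_vec2; congr vec2; first by field.
by rewrite /h; field.
Qed.

Lemma complex_calT_normal (R : realType) (a b : R -> R -> R)
    (mul : 'cV[R]_2 -> 'cV[R]_2 -> 'cV[R]_2) :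
  is_plane_quasifield mul -> parametrizes_left_translations mul a b ->
  is_complex_field mul ->
  normal_subset (calT a b) (left_translations mul (@nonzero _)).
Proof.
move=> hQ hab [f [g [[fK gK] _ _ fM]]].
have mulCA x y z : mul x (mul y z) = mul y (mul x z).
  by apply: (can_inj fK); rewrite !fM mulrCA.
have TL : calT a b `<=` left_mx mul @` (@nonzero _).
  move=> _ [t ht <-]; have [m m0 mE] := calT_mx_left hQ hab ht.
  by exists m.
split; rewrite left_translationsE //.
move=> M [m m0 <-].
have conjE S : calT a b S ->
    left_mx mul m *m S *m invmx (left_mx mul m) = S.
  move=> /TL[n n0 <-]; have -> : left_mx mul m *m left_mx mul n =
      left_mx mul n *m left_mx mul m.
    by apply: mulmx_vec_inj => x; rewrite -!mulmxA -!left_mxP.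
  by rewrite mulmxK // (unit_left_mx hQ hab).
apply/seteqP; split=> [_ [S TS <-]|S TS]; first by rewrite conjE.
by exists S => //; rewrite conjE.
Qed.

Theorem proposition7 (R : realType)
    (mul : 'cV[R]_2 -> 'cV[R]_2 -> 'cV[R]_2) (a b : R -> R -> R)
    (N : set 'cV[R]_2)
    (hQ : is_plane_quasifield mul)
    (hab : parametrizes_left_translations mul a b)
    (N_normal : is_normal_subloop (@nonzero 'cV[R]_2) N mul (vec2 1 0))
    (N_compact : compact N)
    (N_dim : one_dimensional N)
    (N_T : left_translations mul N = calT a b) :
  is_complex_field mul <->
  normal_subset (calT a b) (left_translations mul (@nonzero 'cV[R]_2)).
Proof.
split; first exact: complex_calT_normal.
move=> normT.
have pi0 := pi_gt0 R.
have ht : 0 <= (pi / 2 : R) < 2 * pi by apply/andP; split; lra.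
have a0 := param_a_gt0 hab (parameters1 ht).
have TS : calT a b (calT_mx a b (pi / 2)) by exists (pi / 2).
have := calT_centralized hQ hab normT TS; rewrite calT_mxE.
apply: (complex_of_centralizing hQ hab).
by rewrite sin_pihalf mulr1 oppr_eq0 gt_eqF.
Qed.
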